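(* Let $(X,d)$ be a compact metric space, let $f:X\to\mathbb{R}$ be continuous, and let $M_f=\{x\in X: f(x)=\sup_{y\in X}f(y)\}$. If $M_f$ is connected, then $f$ satisfies the Bhatia-Šemrl property.
   Context: Metric spaces are assumed non-empty. Let $(X,d)$ be a compact metric space and $f:X\to\mathbb{R}$ continuous. Convex extension: a continuous function $p:X\times\mathbb{R}\to\mathbb{R}$ is a convex extension of $f$ if (i) $p(x,0)=f(x)$ for all $x\in X$, and (ii) for each $x\in X$ the function $t\mapsto p(x,t)$ is convex on $\mathbb{R}$. Birkhoff-James extension: a convex extension $p$ of $f$ is a Birkhoff-James extension of $f$ if $g(t)\ge g(0)$ for all $t\in\mathbb{R}$, where $g(t)=\sup_{x\in X}p(x,t)$. Bhatia-Šemrl property: $f$ satisfies the Bhatia-Šemrl property if for every Birkhoff-James extension $p$ of $f$ there exists $\bar{x}\in M_f$ such that $p(\bar{x},t)\ge p(\bar{x},0)=f(\bar{x})$ for all $t\in\mathbb{R}$. *)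

(* Defs.v *)
From HB Require Import structures.
From mathcomp Require Import all_boot all_order all_algebra.
From mathcomp Require Import all_classical all_reals all_analysis.

Set Implicit Arguments.
Unset Strict Implicit.
Unset Printing Implicit Defensive.

Import Order.TTheory GRing.Theory Num.Theory.
Import numFieldNormedType.Exports.

Local Open Scope classical_set_scope.
Local Open Scope ring_scope.

(* [sup] is the real-valued supremum, which defaults to 0 on sets that are
   empty or unbounded above. Over a non-empty compact X, both suprema below are
   suprema of values of continuous functions, so the default is never used. *)

Definition maximizers (R : realType) (X : metricType R) (f : X -> R) : set X :=
  [set x | f x = sup (range f)].

(* [convex_function] is stated for functions on an R-module, hence the copy
   [R^o] of R viewed as a module over itself. *)
Record convex_extension (R : realType) (X : metricType R)
    (f : X -> R) (p : X * R -> R) : Prop := ConvexExtension {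
  convex_extension_continuous : continuous p ;
  convex_extension_at0 : forall x, p (x, 0) = f x ;
  convex_extension_convex : forall x,
    @convex_function R R^o [set: R] (fun t : R => p (x, t)) }.

Definition sup_slice (R : realType) (X : metricType R)
    (p : X * R -> R) (t : R) : R :=
  sup [set p (x, t) | x in [set: X]].

Definition birkhoff_james_extension (R : realType) (X : metricType R)
    (f : X -> R) (p : X * R -> R) : Prop :=
  convex_extension f p /\ forall t : R, sup_slice p 0 <= sup_slice p t.

Definition bhatia_semrl_property (R : realType) (X : metricType R)
    (f : X -> R) : Prop :=
  forall p : X * R -> R, birkhoff_james_extension f p ->
    exists2 x : X, maximizers f x & forall t : R, p (x, 0) <= p (x, t).

(* Main.v *)
(** Suppose no maximizer x of f minimizes t |-> p (x, t) at t = 0. Then at each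
    maximizer the slice drops below its value at 0 for some t > 0 or for some
    t < 0; by convexity not both, and each alternative is an open condition on
    x. By connectedness the same side, say t > 0, works on all of M_f. Each
    point x of X then has a neighbourhood on which p (., t) < max f for all
    small t > 0: near a maximizer because convexity carries the drop from one
    parameter down to all smaller ones, elsewhere because f x < max f. By
    compactness g t < max f = g 0 for some t > 0, contradicting the
    Birkhoff-James condition. *)

Require Import Defs.
From HB Require Import structures.
From mathcomp Require Import all_boot all_order all_algebra.
From mathcomp Require Import all_classical all_reals all_analysis.
From mathcomp Require Import ring lra.

Set Implicit Arguments.
Unset Strict Implicit.
Unset Printing Implicit Defensive.

Import Order.TTheory GRing.Theory Num.Theory.
Import numFieldNormedType.Exports.

Local Open Scope classical_set_scope.
Local Open Scope ring_scope.

(** Since [a < x], writing [x] as a convex combination of [a] and [b] puts positive weight on [b],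
    so the strict inequality at [b] survives. *)
Lemma convex_function_lt (R : realType) (h : R -> R) (a b x m : R) :
  @convex_function R R^o [set: R] h ->
  a < x <= b -> h a <= m -> h b < m -> h x < m.
Proof.
move=> hconv /andP[ax xb] ham hbm.
have ba_gt0 : 0 < b - a by lra.
have l0 : 0 <= (b - x) / (b - a) by apply: divr_ge0; lra.
have l1 : (b - x) / (b - a) < 1 by rewrite ltr_pdivrMr//; lra.
set l := (b - x) / (b - a) in l0 l1.
have : h (l * a + (1 - l) * b) <= l * h a + (1 - l) * h b.
  exact: (hconv (Itv01 l0 (ltW l1)) a b (in_setT _) (in_setT _)).
have -> : l * a + (1 - l) * b = x by rewrite /l; field; lra.
move=> /le_lt_trans; apply.
have : (1 - l) * h b < (1 - l) * m by rewrite ltr_pM2l; lra.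
have : l * h a <= l * m by rewrite ler_wpM2l.
lra.
Qed.

Section Slices.
Context (R : realType) (X : metricType R) (p : X * R -> R).
Context (p_continuous : continuous p)
  (p_convex :
    forall x, @convex_function R R^o [set: R] (fun t : R => p (x, t))).

Lemma continuous_slice (t : R) : continuous (fun x => p (x, t)).
Proof.
move=> x.
have pair_cvg : (fun y : X => (y, t)) @ x --> (x, t).
  apply: (@cvg_pair _ _ _ (nbhs x) (nbhs x) (nbhs t)); first exact: cvg_id.
  exact: cvg_cst.
have p_cvg := @p_continuous (x, t).
exact: (cvg_comp _ _ pair_cvg p_cvg).
Qed.

Definition descent_right : set X :=
  \bigcup_(t in `]0, +oo[) [set x | p (x, t) < p (x, 0)].
Definition descent_left : set X :=
  \bigcup_(t in `]-oo, 0[) [set x | p (x, t) < p (x, 0)].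

Lemma open_slice_lt (t s : R) : open [set x | p (x, t) < p (x, s)].
Proof.
rewrite openE => x /= pxts.
apply: (@filterS _ _ _ [set y | p (y, t) - p (y, s) < 0]).
  by move=> y /=; rewrite subr_lt0.
apply: (@cvgr_lt R _ (nbhs x) _ (fun y => p (y, t) - p (y, s))
                                (p (x, t) - p (x, s))).
  by apply: cvgB; exact: continuous_slice.
by rewrite subr_lt0.
Qed.

(** Drops at some [s < 0] and some [t > 0] would, by convexity between them, force
    [p (x, 0) < p (x, 0)]. *)
Lemma descent_disjoint : descent_right `&` descent_left = set0.
Proof.
rewrite -subset0 => x [[t /= + pt] [s /= + ps]].
rewrite !in_itv/= andbT => t0 s0.
have : p (x, 0) < p (x, 0).
  by apply: (convex_function_lt (@p_convex x) _ (ltW ps) pt); rewrite s0 ltW.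
by rewrite ltxx.
Qed.

Lemma connected_descent (A : set X) :
  connected A -> A `<=` descent_right `|` descent_left ->
  A `<=` descent_right \/ A `<=` descent_left.
Proof.
move=> Aconn Acov.
have or : open descent_right by apply: bigcup_open => t _; exact: open_slice_lt.
have ol : open descent_left by apply: bigcup_open => t _; exact: open_slice_lt.
(* Connectedness only applies to a non-empty clopen part of [A]. *)
have [A0|A0] := eqVneq (A `&` descent_right) set0.
  right=> x Ax; case: (Acov x Ax) => // rx.
  by have : (A `&` descent_right) x by []; rewrite A0.
left; apply/setIidPl; apply: Aconn; first exact/set0P.
  by exists descent_right.
(* Relative closedness: by covering and disjointness, the right part of [A] is what remains outside
   the open set [descent_left]. *)
exists (~` descent_left); first exact: open_closedC.
apply/seteqP; split=> x [Ax]; last by case: (Acov x Ax).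
move=> rx; split=> // lx.
by have := descent_disjoint; rewrite -subset0 => /(_ x); apply.
Qed.

Context (X_nonempty : [set: X] !=set0) (X_compact : compact [set: X]).

(** By compactness the supremum is attained, so a strict bound on all values of a slice passes to
    its supremum. *)
Lemma sup_slice_max (t : R) :
  exists2 x, sup_slice p t = p (x, t) & forall y, p (y, t) <= p (x, t).
Proof.
have [|x _ xmax] := @compact_EVT_max X R (fun x => p (x, t)) _ X_nonempty X_compact.
  by apply: continuous_subspaceT; exact: continuous_slice.
have xmax' y : p (y, t) <= p (x, t) by apply: xmax; rewrite in_setT.
exists x => //; apply/eqP; rewrite eq_le; apply/andP; split.
  by apply: ge_sup; [exists (p (x, t)), x | move=> _ [y _ <-]].
by apply: ub_le_sup; [exists (p (x, t)) => _ [y _ <-] | exists x].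
Qed.

Lemma slice_le_sup (x : X) (t : R) : p (x, t) <= sup_slice p t.
Proof. by have [y -> ] := sup_slice_max t. Qed.

Lemma sup_slice_lt_right :
  [set x | p (x, 0) = sup_slice p 0] `<=` descent_right ->
  exists t, sup_slice p t < sup_slice p 0.
Proof.
move=> Mdesc; set m := sup_slice p 0.
have : \forall t \near 0^'+, [set: X] `<=` [set x | p (x, t) < m].
  (* Compactness reduces a bound uniform in [x] to a product neighbourhood of each [(x, 0)], with
     [t] restricted to positive values. *)
  apply: (compact_near_coveringP _).1 => // x _.
  have [xM|xM] := eqVneq (p (x, 0)) m.
    have [t0 + pt0] := Mdesc x xM; rewrite /= in_itv/= andbT => t0_gt0.
    have Ux : \forall y \near x, p (y, t0) < m.
      apply: (@cvgr_lt R _ (nbhs x) _ (fun y => p (y, t0))).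
        exact: continuous_slice.
      by rewrite -xM.
    exists ([set y | p (y, t0) < m], [set t | 0 < t <= t0]) => /=.
      split=> //; near=> t; apply/andP; split; near: t.
        exact: nbhs_right_gt.
      exact: nbhs_right_le.
    move=> [y t] /= [yt0 t_itv].
    (* The endpoints are [0], where the value is at most [m], and [t0], where it is below [m]; [y]
       need not be a maximizer. *)
    by apply: (convex_function_lt (@p_convex y) t_itv) => //; exact: slice_le_sup.
  have pxm : p (x, 0) < m by rewrite lt_neqAle xM slice_le_sup.
  (* Off the maximizers, joint continuity of [p] suffices. *)
  have [[U V] /= [Ux V0] UV] := cvgr_lt _ (@p_continuous (x, 0)) _ pxm.
  exists (U, V) => /=; first by split=> //; exact: cvg_within.
  by move=> [y t]; exact: UV.
move=> mlt; have [t tlt] := @filter_ex _ _ (at_right_proper_filter 0) _ mlt.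
exists t.
by have [x -> _] := sup_slice_max t; exact: tlt.
Unshelve. all: by end_near.
Qed.

End Slices.

Theorem theorem2p6 (R : realType) (X : metricType R)
    (X_nonempty : [set: X] !=set0) (X_compact : compact [set: X])
    (f : X -> R) (f_continuous : continuous f)
    (Mf_connected : connected (maximizers f)) :
  bhatia_semrl_property f.
Proof.
move=> p [[p_cont p_at0 p_conv] p_bj]; apply: contrapT => no_max.
have p0E : (fun x => p (x, 0)) = f by apply/funext.
have ME : maximizers f = [set x | p (x, 0) = sup_slice p 0].
  by rewrite /maximizers /sup_slice p0E; apply/seteqP; split=> x /=; rewrite p_at0.
have cover : maximizers f `<=` descent_right p `|` descent_left p.
  move=> x Mx; have /existsNP[t] : ~ forall t, p (x, 0) <= p (x, t).
    by move=> xle; apply: no_max; exists x.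
  move=> /negP; rewrite -ltNge => pt.
  have [t0|t0|t0] := ltgtP t 0.
  - by right; exists t => //=; rewrite in_itv.
  - by left; exists t => //=; rewrite in_itv/= t0.
  - by move: pt; rewrite t0 ltxx.
(* Reflecting the parameter reduces descent to the left to descent to the
   right. *)
pose q (z : X * R) : R := p (z.1, - z.2).
have q_cont : continuous q.
  move=> z.
  have reflect_cvg : (fun y : X * R => (y.1, - y.2)) @ z --> (z.1, - z.2).
    apply: (@cvg_pair _ _ _ (nbhs z) (nbhs z.1) (nbhs (- z.2))).
      exact: cvg_fst.
    by apply: cvgN; exact: cvg_snd.
  have p_cvg := @p_cont (z.1, - z.2).
  exact: (cvg_comp _ _ reflect_cvg p_cvg).
have q_conv x : @convex_function R R^o [set: R] (fun t : R => q (x, t)).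
  move=> l s t _ _; rewrite /q /= convN.
  exact: (p_conv x l (- s) (- t) (in_setT _) (in_setT _)).
have [Mr|Ml] := connected_descent p_cont p_conv Mf_connected cover.
  rewrite ME in Mr.
  have [t] := sup_slice_lt_right p_cont p_conv X_nonempty X_compact Mr.
  by rewrite ltNge p_bj.
have qE t : sup_slice q t = sup_slice p (- t) by [].
have [|t] := sup_slice_lt_right q_cont q_conv X_nonempty X_compact.
  rewrite qE /q /= oppr0 -ME => x /Ml[t /=]; rewrite in_itv/= => t0 pt.
  by exists (- t); rewrite /= ?in_itv/= ?oppr_gt0 ?t0//= opprK oppr0.
by rewrite !qE oppr0 ltNge p_bj.
Qed.
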